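(* Let $e$ and $f$ be edges of $G$. In the spanning subgraph toggle group $T(\mathcal{S}(G))$, $(t_et_f)^2=1$ if and only if no cut-set of $G$ contains both $e$ and $f$.
   Context: $G$ is a graph with vertex set $V(G)$ and finite edge set $E(G)$. A spanning subgraph of $G$ is a subset $S\subseteq E(G)$ of the edges of $G$ such that the subgraph $(V(G),S)$, consisting of all the vertices of $G$ and the edges in $S$, has the same number of connected components as $G$. The ground set is $E(G)$, and $\mathcal{S}(G)\subseteq 2^{E(G)}$ is the set of edge sets of spanning subgraphs. For $e\in E(G)$ the toggle $t_e:\mathcal{S}(G)\to\mathcal{S}(G)$ is given by $t_e(X)=X\cup\{e\}$ if $e\notin X$ and $X\cup\{e\}\in\mathcal{S}(G)$; $t_e(X)=X\setminus\{e\}$ if $e\in X$ and $X\setminus\{e\}\in\mathcal{S}(G)$; and $t_e(X)=X$ otherwise. The spanning subgraph toggle group $T(\mathcal{S}(G))$ is the subgroup of the symmetric group on $\mathcal{S}(G)$ generated by the toggles $t_e$, $e\in E(G)$. A cut of a graph is a partition of the vertices into two disjoint subsets. A cut determines a cut-set (also called a co-circuit), defined as the set of edges that have one endpoint in each subset of the partition.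
   Formalization: Here e and f are distinct, V(G) is finite, and a cut-set is a co-circuit: a nonempty inclusion-minimal set of edges crossing a vertex partition. With arbitrary cuts the claim fails for the two edges of a path a-b-c. *)

(* Defs.v *)
From HB Require Import structures.
From mathcomp Require Import all_boot all_fingroup.

Set Implicit Arguments.
Unset Strict Implicit.
Unset Printing Implicit Defensive.

(* Undirected graphs; loops (#|ends e| = 1) and parallel edges are allowed.   *)
Record graph := Graph {
  vertex : finType;
  edge : finType;
  ends : edge -> {set vertex};
  ends_card : forall e : edge, 0 < #|ends e| <= 2
}.

Section SpanningSubgraphs.
Variable G : graph.
Implicit Types (S : {set edge G}) (u v : vertex G).

Definition adj S : rel (vertex G) :=
  fun u v => [exists e in S, ends e == [set u; v]].

Lemma adj_sym S : symmetric (adj S).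
Proof. by move=> u v; rewrite /adj; under eq_existsb do rewrite setUC. Qed.

(* [n_comp] counts components only when [connect] is symmetric, which is      *)
(* the case here by [adj_sym].                                                *)
Definition ncomponents S : nat := n_comp (adj S) [set: vertex G].

Definition spanning_subgraphs : {set {set edge G}} :=
  [set S | ncomponents S == ncomponents [set: edge G]].

Definition cut (A : {set vertex G}) : {set edge G} :=
  [set e | (ends e :&: A != set0) && (ends e :&: ~: A != set0)].

(* Cut-sets are taken in the sense of co-circuits (bonds), that is, nonempty  *)
(* and minimal for inclusion.  A union of disjoint bonds is again of the form *)
(* [cut A]: in the path with edges e and f, the middle vertex against the two *)
(* others gives [set e; f], although both toggles are the identity there.     *)
Definition cut_set (C : {set edge G}) : bool :=
  minset (fun D : {set edge G} => (D != set0) && [exists A, D == cut A]) C.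

End SpanningSubgraphs.

Section Toggles.
Variables (T : finType) (L : {set {set T}}).

Definition family : finType := {X : {set T} | X \in L}.

Definition toggle_set (x : T) (X : {set T}) : {set T} :=
  if (x \notin X) && (x |: X \in L) then x |: X
  else if (x \in X) && (X :\ x \in L) then X :\ x
  else X.

Lemma toggle_set_in x X : X \in L -> toggle_set x X \in L.
Proof. by rewrite /toggle_set; do 2?[case: ifP => [/andP[]|_] //]. Qed.

Lemma toggle_setK x X : X \in L -> toggle_set x (toggle_set x X) = X.
Proof.
move=> XL; rewrite /toggle_set; case: (boolP (x \in X)) => [xX | xX] /=.
- case XxL: (X :\ x \in L) => /=; last by rewrite xX /= XxL.
  by rewrite !inE eqxx /= setD1K // XL.
- case xXL: (x |: X \in L) => /=; last by rewrite xX (negbTE xX) /= xXL.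
  by rewrite !inE eqxx /= setU1K // XL.
Qed.

Definition toggle_fun (x : T) (X : family) : family :=
  exist _ (toggle_set x (val X)) (toggle_set_in x (valP X)).

Lemma toggle_fun_inj x : injective (toggle_fun x).
Proof. by apply: inv_inj => X; apply/val_inj/toggle_setK/(valP X). Qed.

Definition toggle_perm (x : T) : {perm family} := perm (@toggle_fun_inj x).

Definition toggle_group : {group {perm family}} :=
  <<[set toggle_perm x | x : T]>>%G.

Lemma toggle_perm_in x : toggle_perm x \in toggle_group.
Proof. exact/mem_gen/imset_f. Qed.

Definition toggle (x : T) : [subg toggle_group] := Subg (toggle_perm_in x).

End Toggles.

(* Main.v *)
Require Import Defs.
From HB Require Import structures.
From mathcomp Require Import all_boot all_fingroup.

Set Implicit Arguments.
Unset Strict Implicit.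
Unset Printing Implicit Defensive.

(** An edge set is spanning if and only if it meets every nonempty cut, so the
    spanning sets form an up-set. For an up-set [L], comparing the toggles at
    [e] and [f] on the sets [X], [e + X], [f + X], [e + f + X] shows that they
    fail to commute exactly when some [X \notin L] has both [e + X] and [f + X]
    in [L]. If [C] is a minimal nonempty cut containing [e] and [f], its
    complement is such an [X]; conversely a minimal nonempty cut avoiding such
    an [X] has to contain both [e] and [f]. *)

(** * Component counts of nested symmetric relations *)

Section Components.
Variables (T : finType) (e e' : rel T).
Hypotheses (sym_e : connect_sym e) (sym_e' : connect_sym e').
Hypothesis sub_ee' : subrel e e'.

Lemma root_sub x : root e' (root e x) = root e' x.
Proof.
apply/esym/(rootP sym_e'); apply: (connect_sub _ (connect_root e x)) => u v uv.
exact/connect1/sub_ee'.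
Qed.

(** Sending each [e]-root to its [e']-root maps onto the [e']-roots. Equal finite counts make this
    map injective, so [e']-connected points already share their [e]-root. *)
Lemma n_comp_eq_connect :
  n_comp e [set: T] = n_comp e' [set: T] -> connect e =2 connect e'.
Proof.
rewrite /n_comp_mem => eq_n x y.
have rootsT (r : rel T) : [predI roots r & mem [set: T]] =i roots r.
  by move=> z; rewrite !inE andbT.
have img : [seq root e' z | z in roots e] =i roots e'.
  move=> z; apply/imageP/idP => [[w _ ->]|/eqP rz]; first exact: roots_root.
  by exists (root e z); rewrite ?root_sub ?rz //; apply: roots_root.
have /imset_injP inj : #|[set root e' z | z in roots e]| == #|roots e|.
  rewrite -(eq_card (rootsT e)) eq_n (eq_card (rootsT e')) -(eq_card img).
  by apply/eqP/eq_card => z; apply/imsetP/imageP.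
apply/idP/idP => [|cxy].
  by apply: connect_sub => u v uv; apply/connect1/sub_ee'.
apply/(rootP sym_e)/inj; rewrite ?root_sub; try exact: roots_root.
exact/(rootP sym_e').
Qed.

End Components.

(** * Spanning sets, cuts and minimal cuts *)

Section Cuts.
Variable G : graph.
Implicit Types (S : {set edge G}) (A : {set vertex G}).

Lemma adj_connect_sym S : connect_sym (adj S).
Proof. by apply: sym_connect_sym; apply: adj_sym. Qed.

Lemma adj_subset S S' : S \subset S' -> subrel (adj S) (adj S').
Proof.
move=> /subsetP sSS' u v /existsP[g /andP[gS Eg]].
by apply/existsP; exists g; rewrite sSS'.
Qed.

(** An edge meeting both sides has two distinct ends, and [ends_card] leaves room for no third
    vertex. *)
Lemma mem_cut g A :
  reflect (exists x y, [/\ ends g = [set x; y], x \in A & y \notin A])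
          (g \in cut A).
Proof.
rewrite inE; apply: (iffP andP) => [[/set0Pn[x] + /set0Pn[y]]|].
  rewrite !inE => /andP[xg xA] /andP[yg yA]; exists x, y; split=> //.
  apply/esym/eqP; rewrite eqEcard subUset !sub1set xg yg /= cards2.
  have /negbTE -> : x != y by apply: contraNneq yA => <-.
  by have /andP[] := ends_card g.
case=> x [y [-> xA yA]].
by split; apply/set0Pn; [exists x|exists y]; rewrite !inE eqxx ?xA ?yA ?orbT.
Qed.

Lemma adj_cut_closed S A : [disjoint S & cut A] -> closed (adj S) A.
Proof.
move=> dSA; apply: intro_closed; first exact: adj_connect_sym.
move=> x y /existsP[g /andP[gS /eqP Eg]] xA; apply: contraLR gS => yA.
have gA : g \in cut A by apply/mem_cut; exists x, y.
by rewrite (disjointFl dSA gA).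
Qed.

(** If [S] misses a cut, that cut separates unions of [S]-components which an edge of the graph
    joins; equal component counts exclude this. *)
Lemma spanning_subgraphsP S :
  reflect (forall A, cut A != set0 -> ~~ [disjoint S & cut A])
          (S \in spanning_subgraphs G).
Proof.
rewrite inE; apply: (iffP eqP) => [eq_n A|meetS].
  case/set0Pn=> g /mem_cut[x [y [Eg xA yA]]]; apply: contraNN yA => dSA.
  rewrite -(closed_connect (adj_cut_closed dSA) (x := x)) //.
  rewrite (n_comp_eq_connect (adj_connect_sym S) (adj_connect_sym setT) _ eq_n).
    by apply/connect1/existsP; exists g; rewrite in_setT Eg eqxx.
  exact/adj_subset/subsetT.
apply: eq_n_comp => x y; apply/idP/idP; apply: connect_sub => {x y} x y xy.
  exact/connect1/(adj_subset (subsetT S)).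
case/existsP: xy => g /andP[_ /eqP Eg].
(* The [S]-component of [x] has a cut missed by [S], but containing [g] if [y] lies outside it. *)
pose A := [set z | connect (adj S) x z].
have [//|yA] := boolP (connect (adj S) x y).
have /meetS/negP[] : cut A != set0.
  by apply/set0Pn; exists g; apply/mem_cut; exists x, y; rewrite !inE connect0.
rewrite disjoint_sym disjoint_subset.
apply/subsetP => h /mem_cut[u [v [Eh uA vA]]]; rewrite inE.
apply: contra vA => hS; rewrite !inE in uA *; apply: connect_trans uA _.
by apply/connect1/existsP; exists h; rewrite hS Eh eqxx.
Qed.

Lemma spanning_subgraphs_up S S' :
  S \subset S' -> S \in spanning_subgraphs G -> S' \in spanning_subgraphs G.
Proof.
move=> sSS' /spanning_subgraphsP meetS; apply/spanning_subgraphsP => A /meetS.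
by apply: contra => dS'A; apply: disjointWl dS'A.
Qed.

(** A missed nonempty cut contains a minimal one, which is missed as well. *)
Lemma exists_cut_set_disjoint S :
  S \notin spanning_subgraphs G -> exists2 C, cut_set C & [disjoint S & C].
Proof.
move=> nS; pose P (D : {set edge G}) := (D != set0) && [exists A, D == cut A].
have [A PA dSA] : exists2 A, P (cut A) & [disjoint S & cut A].
  have [/existsP[A /andP[? ?]]|noA] :=
    boolP [exists A : {set vertex G}, (cut A != set0) && [disjoint S & cut A]].
    by exists A => //; apply/andP; split=> //; apply/existsP; exists A.
  case/spanning_subgraphsP: nS => A nzA; apply: contra noA => dSA.
  by apply/existsP; exists A; rewrite nzA.
have [C minC sCA] := minset_exists PA.
by exists C => //; apply: disjointWr dSA.
Qed.

Lemma cut_set_meets S C :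
  S \in spanning_subgraphs G -> cut_set C -> ~~ [disjoint S & C].
Proof.
move=> /spanning_subgraphsP meetS /minsetp/andP[nzC /existsP[A /eqP EC]].
by rewrite EC meetS // -EC.
Qed.

Lemma cut_set_setC_notin C : cut_set C -> ~: C \notin spanning_subgraphs G.
Proof.
move=> cutC; apply/negP => /cut_set_meets/(_ cutC).
by rewrite -setI_eq0 setIC setICr eqxx.
Qed.

(** A cut-set missed by [g |: ~: C] would lie inside [C] without [g], against the minimality of
    [C]. *)
Lemma cut_set_setU1C C g :
  cut_set C -> g \in C -> g |: ~: C \in spanning_subgraphs G.
Proof.
move=> cutC gC; apply: contraT => /exists_cut_set_disjoint[D cutD].
rewrite disjoints_subset subUset sub1set inE setCS => /andP[gD sDC].
by rewrite (minsetinf cutC (minsetp cutD) sDC) gC in gD.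
Qed.

End Cuts.

(** * Commuting toggles on an up-set *)

Section ToggleUpset.
Variables (T : finType) (L : {set {set T}}).
Hypothesis upL : forall X Y : {set T}, X \subset Y -> X \in L -> Y \in L.
Implicit Types X : {set T}.

Lemma toggle_set_upE x X : X \in L ->
  toggle_set L x X =
    if x \notin X then x |: X else if X :\ x \in L then X :\ x else X.
Proof.
by move=> XL; rewrite /toggle_set (upL (subsetUr _ _) XL); case: (x \in X).
Qed.


Lemma setU1D1C (x y : T) X : x != y -> (x |: X) :\ y = x |: X :\ y.
Proof.
move=> nxy; apply/setP => z; rewrite !inE.
by case: (z =P x) => // ->; rewrite nxy.
Qed.

(** Stated for arbitrary [e] and [f], so that it also serves with their roles exchanged. *)
Lemma toggle_set_commute_mixed e f X :
    e != f -> (forall X, e |: X \in L -> f |: X \in L -> X \in L) ->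
    X \in L -> e \in X -> f \notin X ->
  toggle_set L e (toggle_set L f X) = toggle_set L f (toggle_set L e X).
Proof.
move=> nef meetL XL eX fX; have nfe : f != e by rewrite eq_sym.
(* Whether [e] can be removed does not depend on the presence of [f]: apply the hypothesis to
   [X :\ e], to which adding [e] gives back [X]. *)
have fXe : ((f |: X) :\ e \in L) = (X :\ e \in L).
  rewrite setU1D1C //; apply/idP/idP => [fXe|]; last exact/upL/subsetUr.
  by apply: meetL => //; rewrite setD1K.
rewrite [LHS]toggle_set_upE ?[RHS]toggle_set_upE ?toggle_set_in //.
rewrite !(toggle_set_upE _ XL) eX fX /= !inE eX orbT fXe /=.
case: ifP => _; last by rewrite fX.
by rewrite !inE (negbTE fX) andbF setU1D1C.
Qed.

Variables (e f : T).
Hypothesis neq_ef : e != f.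

Lemma toggle_set_commute :
    (forall X, e |: X \in L -> f |: X \in L -> X \in L) ->
  {in L, forall X,
    toggle_set L e (toggle_set L f X) = toggle_set L f (toggle_set L e X)}.
Proof.
move=> meetL X XL; have neq_fe : f != e by rewrite eq_sym.
have [eX|eX] := boolP (e \in X); have [fX|fX] := boolP (f \in X).
- have efC : X :\ f :\ e = X :\ e :\ f by rewrite !setDDl setUC.
  (* Both elements can be removed together exactly when each can be removed alone, so neither
     removal blocks the other. *)
  have efL : (X :\ e :\ f \in L) = (X :\ e \in L) && (X :\ f \in L).
    apply/idP/andP => [XefL|[XeL XfL]].
      by split; apply: upL XefL; [|rewrite -efC]; apply: subD1set.
    by apply: meetL; [rewrite -efC|]; rewrite setD1K // !inE ?neq_ef ?neq_fe.
  rewrite [LHS]toggle_set_upE ?[RHS]toggle_set_upE ?toggle_set_in //.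
  rewrite !(toggle_set_upE _ XL) eX fX /=.
  case XeL: (X :\ e \in L); case XfL: (X :\ f \in L);
    by rewrite ?inE ?eX ?fX ?neq_ef ?neq_fe /= ?efC ?efL ?XeL ?XfL.
- exact: toggle_set_commute_mixed.
- by apply/esym/toggle_set_commute_mixed => // Y fY eY; apply: meetL.
rewrite [LHS]toggle_set_upE ?[RHS]toggle_set_upE ?toggle_set_in //.
rewrite !(toggle_set_upE _ XL) eX fX !inE /=.
by rewrite (negbTE eX) (negbTE fX) !orbF neq_ef neq_fe setUCA.
Qed.

Lemma toggle_perm_sqr_eq1 :
  ((toggle_perm L e * toggle_perm L f) ^+ 2 = 1)%g <->
  (forall X, e |: X \in L -> f |: X \in L -> X \in L).
Proof.
split=> [ef1 X eXL fXL | meetL].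
  apply: contraT => nX.
  have eX : e \notin X by apply: contra nX; rewrite -sub1set => /setUidPr <-.
  have fX : f \notin X by apply: contra nX; rewrite -sub1set => /setUidPr <-.
  have YL : e |: (f |: X) \in L by apply: upL fXL; apply: subsetUr.
  have eY : toggle_set L e (e |: (f |: X)) = f |: X.
    rewrite toggle_set_upE // setU11 setU1K ?fXL //.
    by rewrite !inE negb_or neq_ef.
  have fX_id : toggle_set L f (f |: X) = f |: X.
    by rewrite toggle_set_upE // setU11 setU1K // (negbTE nX).
  have Ye : toggle_set L e (f |: X) = e |: (f |: X).
    by rewrite -[in LHS]eY toggle_setK.
  have fY : toggle_set L f (e |: (f |: X)) = e |: X.
    rewrite setUCA in YL *; rewrite toggle_set_upE // setU11 setU1K ?eXL //.
    by rewrite !inE negb_or eq_sym neq_ef.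
  (* Products of permutations act from left to right. Toggling [e], [f], [e], [f] in turn sends [Y]
     to [f |: X], which [f] fixes, then back to [Y] and finally to [e |: X], which lacks [f]. *)
  pose Y : Defs.family L := exist (fun Z => Z \in L) _ YL.
  have /setP/(_ f) := congr1 (fun s : {perm _} => val (s Y)) ef1.
  rewrite expgS expg1 !permM perm1 !permE /= eY fX_id Ye fY.
  by rewrite !inE eqxx orbT eq_sym (negbTE neq_ef) (negbTE fX).
apply/permP => X; rewrite expgS expg1 !permM perm1 !permE; apply: val_inj => /=.
have XL := valP X.
(* Swapping the middle two toggles brings equal ones together, and these cancel as involutions. *)
rewrite (toggle_set_commute meetL) ?toggle_set_in //.
by rewrite !toggle_setK ?toggle_set_in.
Qed.

Lemma toggle_sqr_eq1 :
  ((toggle L e * toggle L f) ^+ 2 = 1)%g <->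
  (forall X, e |: X \in L -> f |: X \in L -> X \in L).
Proof.
apply: iff_trans toggle_perm_sqr_eq1; split=> [/(congr1 val)|ef1] //.
exact: val_inj.
Qed.

End ToggleUpset.

Theorem lemma3p33 (G : graph) (e f : edge G) (hef : e != f) :
  ((toggle (spanning_subgraphs G) e * toggle (spanning_subgraphs G) f) ^+ 2 = 1)%g
  <-> ~ (exists C : {set edge G}, [/\ cut_set C, e \in C & f \in C]).
Proof.
apply: (iff_trans (toggle_sqr_eq1 (@spanning_subgraphs_up G) hef)).
split=> [meetL [C [cutC eC fC]]|noC X eX fX].
  have /negP[] := cut_set_setC_notin cutC.
  by apply: meetL; apply: cut_set_setU1C.
apply: contraT => /exists_cut_set_disjoint[C cutC dXC]; case: noC; exists C.
(* The spanning set [g |: X] meets [C] while [X] does not, so they can only meet in [g]. *)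
have memC g : g |: X \in spanning_subgraphs G -> g \in C.
  move=> /cut_set_meets/(_ cutC); apply: contraNT => gC.
  by rewrite disjoints_subset subUset sub1set inE gC -disjoints_subset.
by split=> //; apply: memC.
Qed.
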